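(* For all integers $n_1,n_2\ge 0$ the Al-Salam-Chihara polynomials $Q_n(x)=Q_n(x;\alpha,\beta|q)$ satisfy $$Q_{n_1}(x)Q_{n_2}(x)=\sum_{n_3\ge 0}C_{n_1,n_2}^{n_3}(\alpha,\beta;q)\,Q_{n_3}(x),$$ where $$C_{n_1,n_2}^{n_3}(\alpha,\beta;q)=(-1)^{n_1+n_2+n_3}\frac{(q;q)_{n_1}(q;q)_{n_2}}{(\alpha\beta;q)_{n_3}}\sum_{m_2,m_3}\frac{(\alpha\beta;q)_{n_1+m_3}\,\alpha^{m_2}\,\beta^{\,n_3+n_2-n_1-m_2-2m_3}\,q^{\binom{m_2}{2}+\binom{n_3+n_2-n_1-m_2-2m_3}{2}}}{(q;q)_{n_3+n_2-n_1-m_2-2m_3}\,(q;q)_{m_2}\,(q;q)_{m_3+n_1-n_3}\,(q;q)_{m_3+n_1-n_2}\,(q;q)_{m_3}},$$ the inner sum being over all integers $m_2,m_3$ such that $m_2$, $m_3$, $n_3+n_2-n_1-m_2-2m_3$, $m_3+n_1-n_3$ and $m_3+n_1-n_2$ are all nonnegative.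
   Context: The Al-Salam-Chihara polynomials $Q_n(x)=Q_n(x;\alpha,\beta|q)$ are defined by $Q_{-1}(x)=0$, $Q_0(x)=1$ and $$Q_{n+1}(x)=(2x-(\alpha+\beta)q^n)Q_n(x)-(1-q^n)(1-\alpha\beta q^{n-1})Q_{n-1}(x),\qquad n\ge 0.$$ Here $(a;q)_0=1$ and $(a;q)_n=\prod_{j=0}^{n-1}(1-aq^j)$. The parameters $\alpha,\beta,q$ are generic (or indeterminates), so that the denominators do not vanish. *)

(* Defs.v *)
From HB Require Import structures.
From mathcomp Require Import all_boot all_order all_algebra.
From mathcomp Require Import boolp classical_sets cardinality fsbigop.

Set Implicit Arguments.
Unset Strict Implicit.
Unset Printing Implicit Defensive.

Import GRing.Theory.
Local Open Scope ring_scope.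
Local Open Scope classical_set_scope.

(* (a; q)_n *)
Definition qpoch (F : fieldType) (a q : F) (n : nat) : F :=
  \prod_(j < n) (1 - a * q ^+ j).

(* Q_n(x; al, be | q) as an element of F[x]. The innermost [else 0] is the
   convention Q_{-1} = 0. *)
Fixpoint ASC (F : fieldType) (al be q : F) (n : nat) : {poly F} :=
  if n is m.+1 then
    (2%:R *: 'X - ((al + be) * q ^+ m)%:P) * ASC al be q m
    - (if m is k.+1 then
         ((1 - q ^+ m) * (1 - al * be * q ^+ k)) *: ASC al be q k
       else 0)
  else 1.

(* The pairs (m2, m3) for which m2, m3, n3 + n2 - n1 - m2 - 2 m3,
   m3 + n1 - n3 and m3 + n1 - n2 are all nonnegative. This set is finite, and
   on it the truncated subtractions of [ASC_term] are exact. *)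
Definition ASC_range (n1 n2 n3 : nat) : set (nat * nat) :=
  [set m | [/\ (n1 + m.1 + 2 * m.2 <= n3 + n2)%N,
               (n3 <= m.2 + n1)%N & (n2 <= m.2 + n1)%N]].

Definition ASC_term (F : fieldType) (al be q : F) (n1 n2 n3 m2 m3 : nat) : F :=
  let e := (n3 + n2 - n1 - m2 - 2 * m3)%N in
  qpoch (al * be) q (n1 + m3) * al ^+ m2 * be ^+ e
    * q ^+ ('C(m2, 2) + 'C(e, 2))
  / (qpoch q q e * qpoch q q m2 * qpoch q q (m3 + n1 - n3)
     * qpoch q q (m3 + n1 - n2) * qpoch q q m3).

Definition ASC_coef (F : fieldType) (al be q : F) (n1 n2 n3 : nat) : F :=
  (-1) ^+ (n1 + n2 + n3)
  * (qpoch q q n1 * qpoch q q n2 / qpoch (al * be) q n3)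
  * \sum_(m \in ASC_range n1 n2 n3) ASC_term al be q n1 n2 n3 m.1 m.2.

(* Main.v *)
Require Import Defs.
From mathcomp Require Import all_boot all_order all_algebra.
From mathcomp Require Import boolp classical_sets cardinality fsbigop.
From mathcomp Require Import zify ring.
Import GRing.Theory.
Local Open Scope ring_scope.
Local Open Scope classical_set_scope.

(* Both sides satisfy the same recurrence in [n1]. Summing over [m2] first, the
   inner sum becomes [g_l], the coefficient of [t^l] in
   [(- al t; q)_oo (- be t; q)_oo], with [l = n3 + n2 - n1 - 2 m3], and the
   coefficient of [Q_n3] is, up to prefactors,
     [S(n1,n2,n3) = sum_m (al be; q)_(n1+m) g_l
        / ((q;q)_(m+n1-n3) (q;q)_(m+n1-n2) (q;q)_m)].
   With [s = al + be] and [P = al be], multiplying by [2x] shows that the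
   theorem reduces to
     [(q^n3 - q^n1) s S(n1,n2,n3)
      = (1 - q^(n3+1)) S(n1,n2,n3+1) + (1 - P q^(n3-1)) S(n1,n2,n3-1)
        - (1 - q^(n1+1)) S(n1+1,n2,n3) - (1 - P q^(n1-1)) S(n1-1,n2,n3)].
   Eliminating [s] through
     [s q^l g_l = (1 - q^(l+1)) g_(l+1) - P q^(l-1) g_(l-1)]
   the coefficients of each [g_j] on both sides agree, by a rational identity
   in the powers of [q]. *)

(** * q-shifted factorials and the identity in powers of [q] *)

Lemma qpoch0 {F : fieldType} (a q : F) : qpoch a q 0 = 1.
Proof. exact: big_ord0. Qed.

Lemma qpochS {F : fieldType} (a q : F) (n : nat) :
  qpoch a q n.+1 = qpoch a q n * (1 - a * q ^+ n).
Proof. by rewrite /qpoch big_ord_recr. Qed.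

Lemma qpoch_neq0 {F : fieldType} (a q : F) (n : nat) :
  (forall j, a * q ^+ j != 1) -> qpoch a q n != 0.
Proof.
move=> aq; rewrite /qpoch; apply/prodf_neq0 => j _.
by rewrite subr_eq0 eq_sym aq.
Qed.

(** The comparison at one fixed [g_l], common factors cancelled. A truncated exponent is harmless:
    its power is multiplied by zero, or occurs in [D] with equal coefficients on both sides. *)
Lemma recurrence_weights {R : comNzRingType} (P q : R) (l a b m : nat) :
  let D := 1 - P * q ^+ (l + a + b + m - 2) in
  (q ^+ (b + m) - q ^+ (a + b)) * (1 - q ^+ l) * D
  - P * (q ^+ (l + b + m - 2) - q ^+ (l + a + b - 2))
    * (1 - q ^+ a) * (1 - q ^+ b) * (1 - q ^+ m)
  = (1 - q ^+ (l + b + m)) * (1 - q ^+ a) * D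
    + (1 - P * q ^+ (l + b + m - 2)) * (1 - q ^+ b) * (1 - q ^+ m)
    - (1 - q ^+ (l + a + b)) * (1 - q ^+ m) * D
    - (1 - P * q ^+ (l + a + b - 2)) * (1 - q ^+ a) * (1 - q ^+ b).
Proof.
case: a => [|a]; case: b => [|b]; case: m => [|m] /=;
  rewrite ?addnS ?addSn ?addn0 ?add0n ?subSS ?subn0 ?expr0 ?subrr ?exprS ?exprD.
all: by ring.
Qed.

Definition zext {F : fieldType} (f : nat -> F) (k : int) : F :=
  if k is Posz n then f n else 0.

(** * Integer-indexed q-factorials and q-exponential coefficients *)

Section Coefficients.

Variables (F : fieldType) (al be q : F).
Hypothesis hq : forall k : nat, (0 < k)%N -> q ^+ k != 1.

Local Notation s := (al + be).
Local Notation P := (al * be).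

(* Negative exponents are truncated to [0] (the case [q = 0] is allowed); they
   only occur in products with a vanishing factor. *)
Definition qpow (k : int) : F := if k is Posz n then q ^+ n else 1.

Let qq_neq0 n : qpoch q q n != 0.
Proof. by apply: qpoch_neq0 => j; rewrite -exprS hq. Qed.

(** The value 0 at negative [k] encodes the conditions on [m3], [m3 + n1 - n3] and
    [m3 + n1 - n2]. *)
Definition qfact_inv (k : int) : F := zext (fun n => (qpoch q q n)^-1) k.

Lemma qfact_inv_pred (k : int) :
  qfact_inv (k - 1) = (1 - qpow k) * qfact_inv k.
Proof.
case: k => [[|n]|n]; rewrite /qfact_inv.
- by rewrite /= expr0 subrr mul0r.
- have -> : (Posz n.+1 - 1)%R = Posz n by lia.
  rewrite /= qpochS -exprS; have := qq_neq0 n; have := qq_neq0 n.+1.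
  rewrite qpochS -exprS mulf_eq0 negb_or => /andP[_ h1] h2.
  by field; rewrite h1 h2.
- have -> : (Negz n - 1)%R = Negz n.+1 by lia.
  by rewrite /= mulr0.
Qed.

(* The coefficients of [(- c t; q)_oo]. *)
Definition qexp_coef (c : F) (n : nat) : F :=
  c ^+ n * q ^+ 'C(n, 2) / qpoch q q n.

Lemma qexp_coefS (c : F) (n : nat) :
  (1 - q ^+ n.+1) * qexp_coef c n.+1 = c * q ^+ n * qexp_coef c n.
Proof.
have := qq_neq0 n.+1; rewrite /qexp_coef qpochS -exprS mulf_eq0 negb_or.
move=> /andP[h1 h2]; rewrite binS bin1 exprD !exprS.
move: h2; rewrite exprS => h2; by field; rewrite h1 h2.
Qed.

(* The coefficients of [G(t) = (- al t; q)_oo (- be t; q)_oo]; [qexp2_coefSS]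
   expresses [G(t) = (1 + al t) (1 + be t) G(q t)]. *)
Definition qexp2_coef (n : nat) : F :=
  \sum_(i < n.+1) qexp_coef al i * qexp_coef be (n - i).

(** The factor [1 - q ^+ i] kills [i = 0] and lowers the index of the [al]-coefficient by
    [qexp_coefS]. *)
Lemma sum_qexp2_left (n : nat) :
  \sum_(i < n.+2) (1 - q ^+ i) * (qexp_coef al i * qexp_coef be (n.+1 - i))
  = al * \sum_(i < n.+1) q ^+ i * (qexp_coef al i * qexp_coef be (n - i)).
Proof.
rewrite big_ord_recl expr0 subrr mul0r add0r big_distrr /=.
apply: eq_bigr => i _; rewrite /bump /= add1n subSS [LHS]mulrA qexp_coefS.
by rewrite !mulrA.
Qed.

Lemma sum_qexp2_right (n : nat) (w : nat -> F) :
  \sum_(i < n.+2) w i * (1 - q ^+ (n.+1 - i))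
    * (qexp_coef al i * qexp_coef be (n.+1 - i))
  = be * \sum_(i < n.+1) w i * q ^+ (n - i)
      * (qexp_coef al i * qexp_coef be (n - i)).
Proof.
rewrite big_ord_recr /= subnn expr0 subrr mulr0 mul0r addr0 big_distrr /=.
apply: eq_bigr => i _; rewrite subSn; last by rewrite -ltnS.
transitivity (w i * qexp_coef al i
  * ((1 - q ^+ (n - i).+1) * qexp_coef be (n - i).+1)); first by ring.
by rewrite qexp_coefS; ring.
Qed.

Lemma qexp2_coefSS (n : nat) :
  (1 - q ^+ n.+2) * qexp2_coef n.+2
  = s * q ^+ n.+1 * qexp2_coef n.+1 + P * q ^+ n * qexp2_coef n.
Proof.
pose E k i := qexp_coef al i * qexp_coef be (k - i).
(* Splits [1 - q^(N+1) = (1 - q^i) + q^i (1 - q^(N+1-i))], one part per series. *)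
have split_ N : (1 - q ^+ N.+1) * qexp2_coef N.+1 =
    al * (\sum_(i < N.+1) q ^+ i * E N i) + be * q ^+ N * qexp2_coef N.
  rewrite -sum_qexp2_left.
  transitivity (\sum_(i < N.+2) ((1 - q ^+ i) * E N.+1 i
      + q ^+ i * (1 - q ^+ (N.+1 - i)) * E N.+1 i)).
    rewrite /qexp2_coef big_distrr /=; apply: eq_bigr => i _.
    have e : q ^+ N.+1 = q ^+ i * q ^+ (N.+1 - i).
      by rewrite -exprD subnKC // -ltnS.
    by rewrite e /E; ring.
  rewrite big_split /= sum_qexp2_right; congr (_ + _).
  rewrite -mulrA; congr (_ * _); rewrite /qexp2_coef big_distrr /=.
  by apply: eq_bigr => i _; rewrite -exprD subnKC // -ltnS.
(* Uses [q^i = q^(n+1) + q^i (1 - q^(n+1-i))]. *)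
have tail : \sum_(i < n.+2) q ^+ i * E n.+1 i
    = q ^+ n.+1 * qexp2_coef n.+1 + be * q ^+ n * qexp2_coef n.
  transitivity (\sum_(i < n.+2) (q ^+ n.+1 * E n.+1 i
      + q ^+ i * (1 - q ^+ (n.+1 - i)) * E n.+1 i)).
    apply: eq_bigr => i _.
    have e : q ^+ n.+1 = q ^+ i * q ^+ (n.+1 - i).
      by rewrite -exprD subnKC // -ltnS.
    by rewrite e; ring.
  rewrite big_split /= sum_qexp2_right -big_distrr /=; congr (_ + _).
  rewrite -mulrA; congr (_ * _); rewrite /qexp2_coef big_distrr /=.
  by apply: eq_bigr => i _; rewrite -exprD subnKC // -ltnS.
by rewrite split_ tail; ring.
Qed.

Lemma qexp_coef0 (c : F) : qexp_coef c 0 = 1.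
Proof. by rewrite /qexp_coef qpoch0 invr1 !mulr1. Qed.

Lemma qexp2_coef0 : qexp2_coef 0 = 1.
Proof. by rewrite /qexp2_coef big_ord1 !qexp_coef0 mulr1. Qed.

Lemma qexp2_coef1 : (1 - q) * qexp2_coef 1 = s.
Proof.
have e1 c : (1 - q) * qexp_coef c 1 = c.
  by rewrite -[q in LHS]expr1 qexp_coefS qexp_coef0 !mulr1.
rewrite /qexp2_coef big_ord_recr big_ord1 /= !qexp_coef0 mulr1 mul1r mulrDr.
by rewrite !e1 addrC.
Qed.

(** The relation eliminating [s]. At [k = -1] the factor [1 - qpow 0] kills [g_0]; at [k = 0] the
    truncated [qpow (-1)] multiplies a zero. *)
Lemma zext_qexp2_recurrence (k : int) :
  s * qpow k * zext qexp2_coef k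
  = (1 - qpow (k + 1)) * zext qexp2_coef (k + 1)
    - P * qpow (k - 1) * zext qexp2_coef (k - 1).
Proof.
case: k => [[|[|n]]|[|n]].
- by rewrite /= qexp2_coef0 -qexp2_coef1 expr0 expr1; ring.
- by have := qexp2_coefSS 0; rewrite /= => ->; ring.
- have -> : (Posz n.+2 - 1)%R = Posz n.+1 by lia.
  have -> : (Posz n.+2 + 1)%R = Posz n.+3 by lia.
  by rewrite /= qexp2_coefSS; ring.
- by rewrite /= expr0; ring.
- have -> : (Negz n.+1 + 1)%R = Negz n by lia.
  have -> : (Negz n.+1 - 1)%R = Negz n.+2 by lia.
  by rewrite /=; ring.
Qed.

(** * The summand and its two relations *)

Lemma qpowD (i j : int) : (0 <= i)%R -> (0 <= j)%R ->
  qpow (i + j) = qpow i * qpow j.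
Proof. by case: i => // i _; case: j => // j _; rewrite -PoszD /= exprD. Qed.

(* With [k = l + a + b + m] this is the summand of
   [C_(l+a+b, l+a+m)^(l+b+m)], up to a factor independent of [m]. *)
Definition lin_term (k l a b m : int) : F :=
  zext (qpoch P q) k * zext qexp2_coef l
  * qfact_inv a * qfact_inv b * qfact_inv m.

Lemma lin_term_eq0 (k l a b m : int) :
  [|| l < 0, a < 0, b < 0 | m < 0]%R -> lin_term k l a b m = 0.
Proof.
rewrite /lin_term /qfact_inv.
by case: l a b m => [l|l] [a|a] [b|b] [m|m] //= _; rewrite ?mulr0 ?mul0r.
Qed.

(** Factoring [q^l] out of the difference of powers exposes [s q^l g_l], which
    [zext_qexp2_recurrence] rewrites. *)
Lemma lin_term_sum_coef (k l a b m : int) :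
  s * (qpow (l + b + m) - qpow (l + a + b)) * lin_term k l a b m
  = (qpow (b + m) - qpow (a + b)) * (1 - qpow (l + 1))
      * lin_term k (l + 1) a b m
    - P * (qpow (l + b + m - 1) - qpow (l + a + b - 1))
      * lin_term k (l - 1) a b m.
Proof.
have [neg|] := boolP [|| a < 0, b < 0 | m < 0]%R.
  by rewrite !lin_term_eq0 ?neg ?orbT // !mulr0 subrr.
rewrite !negb_or -!Order.TotalTheory.leNgt => /and3P[a0 b0 m0].
have [l_lt0|l_ge0] := Order.TotalTheory.ltP l 0.
  rewrite (lin_term_eq0 k l) ?l_lt0 // (lin_term_eq0 k (l - 1)); last by lia.
  rewrite !mulr0 subr0; have [->|?] := eqVneq l (- 1).
    by rewrite /= expr0 subrr mulr0 mul0r.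
  by rewrite lin_term_eq0 ?mulr0 //; lia.
have E (x y : int) : (0 <= x)%R -> (0 <= y)%R ->
    qpow (l + x + y) = qpow l * qpow (x + y).
  by move=> x0 y0; rewrite -addrA [LHS]qpowD // Num.Theory.addr_ge0.
(* At [l = 0] truncation breaks the additivity of exponents, so the vanishing factor at [l - 1] is
   kept. *)
have E1 (x y : int) : (0 <= x)%R -> (0 <= y)%R ->
    qpow (l + x + y - 1) * zext qexp2_coef (l - 1)
    = qpow (l - 1) * qpow (x + y) * zext qexp2_coef (l - 1).
  move=> x0 y0; have [->|l_neq0] := eqVneq l 0; first by rewrite !mulr0.
  have -> : (l + x + y - 1 = (l - 1) + (x + y))%R by ring.
  by rewrite [qpow (_ - 1 + _)]qpowD //; lia.
rewrite /lin_term; have R := zext_qexp2_recurrence l.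
set Z := zext (qpoch P q) k; set ra := qfact_inv a; set rb := qfact_inv b.
set rm := qfact_inv m; rewrite !E //.
transitivity ((qpow (b + m) - qpow (a + b)) * Z * ra * rb * rm
  * (s * qpow l * zext qexp2_coef l)); first by ring.
rewrite R; have h1 := E1 _ _ b0 m0; have h2 := E1 _ _ a0 b0.
transitivity ((qpow (b + m) - qpow (a + b)) * (1 - qpow (l + 1))
  * (Z * zext qexp2_coef (l + 1) * ra * rb * rm)
  - P * Z * ra * rb * rm
    * (qpow (l + b + m - 1) * zext qexp2_coef (l - 1)
       - qpow (l + a + b - 1) * zext qexp2_coef (l - 1))); last by ring.
by rewrite h1 h2; ring.
Qed.

Lemma lin_term_recurrence (l a b m : int) :
  (0 < l + a + b)%R -> (0 < l + b + m)%R ->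
  let N := (l + a + b + m)%R in
  (qpow (b + m) - qpow (a + b)) * (1 - qpow l) * lin_term (N - 1) l a b m
  - P * (qpow (l + b + m - 2) - qpow (l + a + b - 2))
    * lin_term (N - 2) l (a - 1) (b - 1) (m - 1)
  = (1 - qpow (l + b + m)) * lin_term (N - 1) l (a - 1) b m
    + (1 - P * qpow (l + b + m - 2)) * lin_term (N - 2) l a (b - 1) (m - 1)
    - (1 - qpow (l + a + b)) * lin_term (N - 1) l a b (m - 1)
    - (1 - P * qpow (l + a + b - 2)) * lin_term (N - 2) l (a - 1) (b - 1) m.
Proof.
have [neg|] := boolP [|| l < 0, a < 0, b < 0 | m < 0]%R.
  by move=> _ _ N; rewrite !lin_term_eq0; [rewrite !mulr0; ring | lia ..].
case: l a b m => [l|l] [a|a] [b|b] [m|m] // _; rewrite -!PoszD => h1 h2 /=.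
have trunc k : qpow (Posz k - 2) = q ^+ (k - 2).
  by case: k => [|[|k]] //=; have -> : (Posz k.+2 - 2)%R = Posz k by lia.
(* For [N >= 2], [(P; q)_(N-1)] splits off [1 - P q^(N-2)], the [D] of [recurrence_weights].
   Otherwise positivity forces [a = m = 0] and every term vanishes. *)
have [N1|N2] := leqP (l + a + b + m)%N 1.
  have [-> ->] : a = 0%N /\ m = 0%N by lia.
  rewrite !addn0 !add0n subrr !mul0r.
  by rewrite !lin_term_eq0 /=; [rewrite !mulr0 ?mul0r; ring | lia ..].
rewrite /lin_term !qfact_inv_pred !trunc /=.
have -> : (Posz (l + a + b + m) - 1)%R = Posz (l + a + b + m - 2).+1 by lia.
have -> : (Posz (l + a + b + m) - 2)%R = Posz (l + a + b + m - 2) by lia.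
rewrite /= qpochS; have := recurrence_weights P q l a b m => /=.
set p := qpoch _ _ _; set g := qexp2_coef l => W.
set ra := (qpoch q q a)^-1; set rb := (qpoch q q b)^-1.
set rm := (qpoch q q m)^-1.
apply: etrans (etrans (congr1 (fun x => x * (p * g * ra * rb * rm)) W) _).
  by ring.
by ring.
Qed.

(** * The sum over [m] and its recurrence in [n1] *)

Definition lin_summand (n1 n2 n3 m : int) : F :=
  lin_term (n1 + m) (n3 + n2 - n1 - 2 * m) (n1 + m - n3) (n1 + m - n2) m.

(* The summand vanishes for [m > n2]; the extra index [n2 + 1] lets the range
   absorb the shift [m -> m - 1]. *)
Definition lin_sum (n1 n2 n3 : int) : F :=
  \sum_(m < `|n2|.+2) lin_summand n1 n2 n3 (Posz m).

Lemma lin_summand_eq0 (n1 n2 n3 m : int) :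
  [|| n2 < m, m < 0, n1 < 0, n3 < 0 | n1 + n2 < n3]%R ->
  lin_summand n1 n2 n3 m = 0.
Proof. by move=> h; rewrite /lin_summand lin_term_eq0 //; lia. Qed.

Lemma lin_sum_eq0 (n1 n2 n3 : int) :
  [|| n1 < 0, n3 < 0 | n1 + n2 < n3]%R -> lin_sum n1 n2 n3 = 0.
Proof.
move=> h; rewrite /lin_sum big1 // => m _; rewrite lin_summand_eq0 //; lia.
Qed.

Lemma sum_shift_pred (f : int -> F) (n : nat) :
  f (- 1) = 0 -> f (Posz n) = 0 ->
  \sum_(m < n.+1) f (Posz m) = \sum_(m < n.+1) f (Posz m - 1).
Proof.
move=> f1 fn; rewrite big_ord_recr /= fn addr0 big_ord_recl /= sub0r f1 add0r.
by apply: eq_bigr => i _; congr f; rewrite /bump /=; lia.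
Qed.

Lemma lin_sum_recurrence (n1 n2 n3 : nat) :
  s * (q ^+ n3 - q ^+ n1) * lin_sum n1 n2 n3
  = (1 - q ^+ n3.+1) * lin_sum n1 n2 n3.+1
    + (1 - P * qpow (Posz n3 - 1)) * lin_sum n1 n2 (Posz n3 - 1)
    - (1 - q ^+ n1.+1) * lin_sum n1.+1 n2 n3
    - (1 - P * qpow (Posz n1 - 1)) * lin_sum (Posz n1 - 1) n2 n3.
Proof.
pose l (m : int) := (Posz n3 + Posz n2 - Posz n1 - 2 * m)%R.
pose a (m : int) := (Posz n1 + m - Posz n3)%R.
pose b (m : int) := (Posz n1 + m - Posz n2)%R.
pose U (m : int) := (qpow (b m + m) - qpow (a m + b m)) * (1 - qpow (l m + 1))
  * lin_term (Posz n1 + m) (l m + 1) (a m) (b m) m.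
pose V (m : int) := P * (qpow (Posz n3 - 1) - qpow (Posz n1 - 1))
  * lin_term (Posz n1 + m) (l m - 1) (a m) (b m) m.
pose W1 (m : int) := (1 - q ^+ n3.+1) * lin_summand n1 n2 n3.+1 m.
pose W2 (m : int) :=
  (1 - P * qpow (Posz n3 - 1)) * lin_summand n1 n2 (Posz n3 - 1) m.
pose W3 (m : int) := (1 - q ^+ n1.+1) * lin_summand n1.+1 n2 n3 m.
pose W4 (m : int) :=
  (1 - P * qpow (Posz n1 - 1)) * lin_summand (Posz n1 - 1) n2 n3 m.
have shift (f : int -> F) :
    (forall m, (Posz n2 < m)%R || (m < 0)%R -> f m = 0) ->
    \sum_(m < n2.+2) f (Posz m) = \sum_(m < n2.+2) f (Posz m - 1).
  by move=> f0; apply: sum_shift_pred; apply: f0; lia.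
(* The [V]-part of the middle coefficient is shifted by one in [m], so that
   all terms carry the same factor [qexp2_coef (l m + 1)]. *)
have key (m : int) :
    U m - V (m - 1) = W1 m + W2 (m - 1) - W3 (m - 1) - W4 m.
  have := lin_term_recurrence (l m + 1) (a m) (b m) m.
  have e1 : (l m + 1 + a m + b m = Posz n1.+1)%R by rewrite /l /a /b; lia.
  have e2 : (l m + 1 + b m + m = Posz n3.+1)%R by rewrite /l /a /b; lia.
  have e3 : (Posz n1.+1 - 2 = Posz n1 - 1)%R by lia.
  have e4 : (Posz n3.+1 - 2 = Posz n3 - 1)%R by lia.
  rewrite e1 e2 e3 e4 => /(_ isT isT).
  rewrite /U /V /W1 /W2 /W3 /W4 /lin_summand.
  move=> K; apply: etrans (etrans K _).
    by congr (_ * lin_term _ _ _ _ _ - _ * lin_term _ _ _ _ _);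
      rewrite /l /a /b; lia.
  by congr (_ * lin_term _ _ _ _ _ + _ * lin_term _ _ _ _ _
      - _ * lin_term _ _ _ _ _ - _ * lin_term _ _ _ _ _);
    rewrite /l /a /b; lia.
have mid (m : int) :
    s * (q ^+ n3 - q ^+ n1) * lin_summand n1 n2 n3 m = U m - V m.
  have := lin_term_sum_coef (Posz n1 + m) (l m) (a m) (b m) m.
  have -> : (l m + b m + m = Posz n3)%R by rewrite /l /a /b; lia.
  by have -> : (l m + a m + b m = Posz n1)%R by rewrite /l /a /b; lia.
have V0 m : (Posz n2 < m)%R || (m < 0)%R -> V m = 0.
  by move=> h; rewrite /V lin_term_eq0 ?mulr0 // /l /a /b; lia.
have W20 m : (Posz n2 < m)%R || (m < 0)%R -> W2 m = 0.
  by move=> h; rewrite /W2 lin_summand_eq0 ?mulr0 //; lia.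
have W30 m : (Posz n2 < m)%R || (m < 0)%R -> W3 m = 0.
  by move=> h; rewrite /W3 lin_summand_eq0 ?mulr0 //; lia.
rewrite /lin_sum !big_distrr /=; under eq_bigr do rewrite mid.
(* [V], [W2] and [W3] vanish outside [0 <= m <= n2], so shifting them lets [key] apply termwise. *)
rewrite sumrB (shift V V0) -sumrB.
transitivity (\sum_(m < n2.+2)
    (W1 (Posz m) + W2 (Posz m - 1) - W3 (Posz m - 1) - W4 (Posz m))).
  by apply: eq_bigr => m _; apply: key.
by rewrite !sumrB big_split /= -(shift W2 W20) -(shift W3 W30).
Qed.

(** For [n1 = 0], the constraints [m >= n2], [m >= n3] and [2 m <= n2 + n3] leave only
    [m = n2 = n3]. *)
Lemma lin_sum0n (n2 n3 : nat) :
  lin_sum 0 n2 n3 = (n2 == n3)%:R * (qpoch P q n2 / qpoch q q n2).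
Proof.
rewrite /lin_sum /=; case: eqVneq => [<-|neq]; last first.
  rewrite mul0r big1 // => m _.
  by rewrite /lin_summand lin_term_eq0 //; lia.
rewrite big_ord_recr big_ord_recr /= big1 ?add0r; last first.
  move=> m _; have m_lt := ltn_ord m.
  by rewrite /lin_summand lin_term_eq0 //=; lia.
rewrite (lin_summand_eq0 0 n2 n2 n2.+1) ?addr0 ?mul1r; last by lia.
rewrite /lin_summand; have -> : (Posz n2 + n2 - 0 - 2 * Posz n2 = 0)%R by lia.
rewrite add0r subrr /lin_term /qfact_inv /= qexp2_coef0.
by rewrite qpoch0 invr1 !mulr1.
Qed.

(** * Identification with the coefficients of the theorem *)

Lemma ASC_term_qexp (n1 n2 n3 i m : nat) :
  (n1 + i + 2 * m <= n3 + n2)%N ->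
  ASC_term al be q n1 n2 n3 i m =
  qpoch P q (n1 + m)
  * (qexp_coef al i * qexp_coef be (n3 + n2 - n1 - 2 * m - i))
  / (qpoch q q (m + n1 - n3) * qpoch q q (m + n1 - n2) * qpoch q q m).
Proof.
move=> le; rewrite /ASC_term.
have -> : (n3 + n2 - n1 - i - 2 * m = n3 + n2 - n1 - 2 * m - i)%N by lia.
rewrite /qexp_coef exprD; field.
by rewrite !qq_neq0.
Qed.

(** For fixed [m3], the sum over [m2] is the convolution [qexp2_coef]. *)
Lemma lin_sumE (n1 n2 n3 : nat) :
  \sum_(m \in ASC_range n1 n2 n3) ASC_term al be q n1 n2 n3 m.1 m.2
  = lin_sum n1 n2 n3.
Proof.
pose inside (m : nat * nat) := [&& (n1 + m.1 + 2 * m.2 <= n3 + n2)%N,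
  (n3 <= m.2 + n1)%N & (n2 <= m.2 + n1)%N].
have -> : ASC_range n1 n2 n3 = [set` inside].
  by apply/seteqP; split=> m /= /and3P.
(* A rectangle containing the range: the constraints give [m3 <= n2], and the bound [n2.+2] matches
   [lin_sum]. *)
rewrite -(@bigfs _ _ _ _ [seq (i, m) | m <- index_iota 0 n2.+2,
  i <- index_iota 0 (n3 + n2).+1]); first last.
- move=> [i m] /and3P[h1 h2 h3] /negP[]; apply/allpairsPdep.
  exists m, i; move: h1 h2 h3; rewrite !mem_index_iota /=.
  by split => //; lia.
- by apply: allpairs_uniq; rewrite ?iota_uniq // => -[? ?] [? ?] _ _ /= [-> ->].
rewrite big_mkcond big_allpairs_dep big_mkord; apply: eq_bigr => m _.
rewrite big_mkord /inside /=.
have [/and3P[h1 h2 h3]|out] := boolP [&& (n1 + 2 * m <= n3 + n2)%N,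
  (n3 <= m + n1)%N & (n2 <= m + n1)%N]; last first.
  rewrite big1 ?/lin_summand ?lin_term_eq0 //; first by lia.
  by move=> i _; case: ifP => //; lia.
rewrite /lin_summand /lin_term /qfact_inv.
have -> : (Posz n3 + Posz n2 - Posz n1 - 2 * Posz m)%R
  = Posz (n3 + n2 - n1 - 2 * m) by lia.
have -> : (Posz n1 + Posz m - Posz n3)%R = Posz (m + n1 - n3) by lia.
have -> : (Posz n1 + Posz m - Posz n2)%R = Posz (m + n1 - n2) by lia.
rewrite -PoszD /= /qexp2_coef -big_mkcond /=.
rewrite (big_ord_widen (n3 + n2).+1
  (fun i => qexp_coef al i * qexp_coef be (n3 + n2 - n1 - 2 * m - i)%N));
  last by lia.
rewrite big_distrr !big_distrl /=; apply: eq_big => [i|i /and3P[h _ _]].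
  by apply/and3P/idP => [[h _ _]|h]; [|split]; lia.
by rewrite ASC_term_qexp // !invfM !mulrA.
Qed.

Lemma ASC_coefE (n1 n2 n3 : nat) :
  ASC_coef al be q n1 n2 n3 = (-1) ^+ (n1 + n2 + n3)
    * (qpoch q q n1 * qpoch q q n2 / qpoch P q n3) * lin_sum n1 n2 n3.
Proof. by rewrite /ASC_coef lin_sumE. Qed.

Lemma ASC_coef_eq0 (n1 n2 n3 : nat) :
  (n1 + n2 < n3)%N -> ASC_coef al be q n1 n2 n3 = 0.
Proof. by move=> h; rewrite ASC_coefE lin_sum_eq0 ?mulr0 //; lia. Qed.

Hypothesis hab : forall j : nat, P * q ^+ j != 1.

Let Pq_neq0 n : qpoch P q n != 0.
Proof. exact: qpoch_neq0. Qed.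

Lemma ASC_coef0n (n2 n3 : nat) : ASC_coef al be q 0 n2 n3 = (n2 == n3)%:R.
Proof.
rewrite ASC_coefE lin_sum0n; case: eqVneq => [<-|]; last by rewrite mul0r mulr0.
rewrite add0n addnn -signr_odd odd_double expr0 qpoch0; field.
by rewrite Pq_neq0 qq_neq0.
Qed.

(** Matches the coefficients of [Q_n3] in two expansions of [2x Q_n1 Q_n2]. It is
    [lin_sum_recurrence] times the prefactor [K]; a shift of one index by one flips the sign, hence
    [- K]. *)
Lemma ASC_coefS (n1 n2 n3 : nat) :
  ASC_coef al be q n1.+1 n2 n3
  = (if n3 is k.+1 then ASC_coef al be q n1 n2 k else 0)
    + s * (q ^+ n3 - q ^+ n1) * ASC_coef al be q n1 n2 n3
    + (1 - q ^+ n3.+1) * (1 - P * q ^+ n3) * ASC_coef al be q n1 n2 n3.+1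
    - (if n1 is k.+1 then
         (1 - q ^+ n1) * (1 - P * q ^+ k) * ASC_coef al be q k n2 n3
       else 0).
Proof.
pose K := (-1) ^+ (n1 + n2 + n3) * (qpoch q q n1 * qpoch q q n2 / qpoch P q n3).
have EA : (if n3 is k.+1 then ASC_coef al be q n1 n2 k else 0)
    = - K * ((1 - P * qpow (Posz n3 - 1)) * lin_sum n1 n2 (Posz n3 - 1)).
  rewrite {}/K; case: n3 => [|k]; first by rewrite lin_sum_eq0 ?mulr0.
  have -> : (Posz k.+1 - 1 = Posz k)%R by lia.
  rewrite ASC_coefE qpochS addnS exprS /=.
  have := Pq_neq0 k; have := Pq_neq0 k.+1; rewrite qpochS mulf_eq0 negb_or.
  by move=> /andP[_ h1] h2; field; rewrite h1 h2.
have EB : (if n1 is k.+1 then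
      (1 - q ^+ n1) * (1 - P * q ^+ k) * ASC_coef al be q k n2 n3 else 0)
    = - K * ((1 - P * qpow (Posz n1 - 1)) * lin_sum (Posz n1 - 1) n2 n3).
  clear EA; rewrite {}/K; case: n1 => [|k]; first by rewrite lin_sum_eq0 ?mulr0.
  have -> : (Posz k.+1 - 1 = Posz k)%R by lia.
  by rewrite ASC_coefE qpochS !addSn !exprS /=; ring.
have EC : (1 - P * q ^+ n3) * ASC_coef al be q n1 n2 n3.+1
    = - K * lin_sum n1 n2 n3.+1.
  rewrite ASC_coefE /K addnS exprS qpochS.
  have := Pq_neq0 n3.+1; rewrite qpochS mulf_eq0 negb_or => /andP[h1 h2].
  by field; rewrite h1 h2.
have ED : ASC_coef al be q n1.+1 n2 n3
    = - K * ((1 - q ^+ n1.+1) * lin_sum n1.+1 n2 n3).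
  by rewrite ASC_coefE /K !addSn !exprS qpochS; ring.
rewrite ED EA EB -[_ * _ * ASC_coef _ _ _ _ _ n3.+1]mulrA EC ASC_coefE -/K.
have R := lin_sum_recurrence n1 n2 n3.
transitivity (K * ((s * (q ^+ n3 - q ^+ n1) * lin_sum n1 n2 n3)
  - (1 - q ^+ n3.+1) * lin_sum n1 n2 n3.+1
  - (1 - P * qpow (Posz n3 - 1)) * lin_sum n1 n2 (Posz n3 - 1)
  + (1 - P * qpow (Posz n1 - 1)) * lin_sum (Posz n1 - 1) n2 n3)).
  by rewrite R; ring.
by ring.
Qed.

End Coefficients.

(** * Expansion of products of the polynomials *)

#[local] Arguments ASC {F} al be q n : simpl never.

Lemma ASCS {F : fieldType} (al be q : F) (n : nat) :
  ASC al be q n.+1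
  = (2%:R *: 'X - ((al + be) * q ^+ n)%:P) * ASC al be q n
    - (if n is k.+1 then
         ((1 - q ^+ n) * (1 - al * be * q ^+ k)) *: ASC al be q k
       else 0).
Proof. by []. Qed.

Lemma ASC_mulX {F : fieldType} (al be q : F) (n : nat) :
  2%:R *: 'X * ASC al be q n
  = ASC al be q n.+1 + ((al + be) * q ^+ n) *: ASC al be q n
    + (if n is k.+1 then
         ((1 - q ^+ n) * (1 - al * be * q ^+ k)) *: ASC al be q k
       else 0).
Proof. by rewrite ASCS mulrBl mul_polyC [RHS]addrAC !subrK. Qed.

(** Multiplication by [2x] creates a term in [Q_(K+1)], which [c K = 0] removes. *)
Lemma sum_mulX {F : fieldType} (al be q : F) (c : nat -> F) (K : nat) :
  (forall n, (K <= n)%N -> c n = 0) ->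
  2%:R *: 'X * (\sum_(i < K.+1) c i *: ASC al be q i)
  = \sum_(i < K.+1) ((if val i is k.+1 then c k else 0)
      + (al + be) * q ^+ i * c i
      + (1 - q ^+ i.+1) * (1 - al * be * q ^+ i) * c i.+1) *: ASC al be q i.
Proof.
move=> cK; rewrite big_distrr /=.
transitivity (\sum_(i < K.+1) (c i *: ASC al be q i.+1
  + ((al + be) * q ^+ i * c i) *: ASC al be q i
  + c i *: (if val i is k.+1 then
      ((1 - q ^+ i) * (1 - al * be * q ^+ k)) *: ASC al be q k else 0))).
  apply: eq_bigr => i _; rewrite -scalerAr ASC_mulX !scalerDr scalerA.
  by rewrite [_ * c i]mulrC.
under [RHS]eq_bigr do rewrite !scalerDl.
rewrite !big_split /=; congr (_ + _ + _).
  rewrite big_ord_recr /= cK // scale0r addr0 [RHS]big_ord_recl scale0r add0r.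
  by apply: eq_bigr.
rewrite big_ord_recl /= scaler0 add0r [RHS]big_ord_recr /= cK // mulr0.
rewrite scale0r addr0; apply: eq_bigr => i _.
by rewrite /bump /= add1n scalerA mulrC.
Qed.

(** Strong induction on [n1], as the recurrence has two terms below. One bound [K] gives all
    products a common index range. *)
Lemma ASC_mul_sum (F : fieldType) (al be q : F)
  (hq : forall k : nat, (0 < k)%N -> q ^+ k != 1)
  (hab : forall j : nat, al * be * q ^+ j != 1)
  (n1 n2 K : nat) :
  (n1 + n2 < K)%N ->
  ASC al be q n1 * ASC al be q n2 =
  \sum_(n3 < K.+1) ASC_coef al be q n1 n2 n3 *: ASC al be q n3.
Proof.
move: n1; apply: ltn_ind => -[|n1] IH ltK.
  have ltK' : (n2 < K.+1)%N by lia.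
  rewrite mul1r (bigD1 (Ordinal ltK')) //= big1 => [|i /eqP ne].
    by rewrite ASC_coef0n // eqxx scale1r addr0.
  rewrite ASC_coef0n //; case: eqP => [e|]; last by rewrite scale0r.
  by case: ne; apply: val_inj.
have cK n : (K <= n)%N -> ASC_coef al be q n1 n2 n = 0.
  by move=> h; apply: ASC_coef_eq0 => //; lia.
have E := sum_mulX al be q _ _ cK.
rewrite -IH // in E; last by lia.
rewrite ASCS !mulrBl -[2%:R *: _ * _ * _]mulrA E.
have -> : (if n1 is k.+1 then ((1 - q ^+ n1) * (1 - al * be * q ^+ k))
      *: ASC al be q k else 0) * ASC al be q n2
    = \sum_(i < K.+1) (if n1 is k.+1 then (1 - q ^+ n1)
        * (1 - al * be * q ^+ k) * ASC_coef al be q k n2 i else 0)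
        *: ASC al be q i.
  clear E; case: n1 IH ltK cK => [|k] IH ltK _.
    by rewrite mul0r big1 // => i _; rewrite scale0r.
  rewrite -scalerAl IH //; last by lia.
  by rewrite scaler_sumr; apply: eq_bigr => i _; rewrite scalerA.
rewrite mul_polyC -scalerAl (IH n1) //; last by lia.
rewrite scaler_sumr -!sumrB; apply: eq_bigr => i _.
rewrite scalerA -!scalerBl; congr (_ *: _); rewrite ASC_coefS //=.
set lower := match nat_of_ord i with 0%N => _ | _ => _ end.
set prev := match n1 with 0%N => _ | _ => _ end.
ring.
Qed.

Theorem theorem1 (F : fieldType) (al be q : F)
  (hq : forall k : nat, (0 < k)%N -> q ^+ k != 1)
  (hab : forall j : nat, al * be * q ^+ j != 1)
  (n1 n2 : nat) :
  ASC al be q n1 * ASC al be q n2 =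
  \sum_(n3 \in [set: nat]) ASC_coef al be q n1 n2 n3 *: ASC al be q n3.
Proof.
(* The coefficients vanish for [n3 > n1 + n2], so this finite sum is the whole sum. *)
rewrite (ASC_mul_sum F al be q hq hab n1 n2 (n1 + n2).+1) //.
rewrite (fsbig_ord _ _ (fun n => ASC_coef al be q n1 n2 n *: ASC al be q n)).
apply: fsbig_widen => // n [_ /= /negP]; rewrite -leqNgt => n_big.
by rewrite ASC_coef_eq0 ?scale0r //; lia.
Qed.
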